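(* For $n\geq 2$ and $0<a\leq\frac{1}{\sqrt{n}}$, the map $$f:(\mathbb{H}^1,d_{N_{\infty,a}})\to(\mathbb{H}^n,d_{N_{\infty,a}}),\quad (x,y,t)\mapsto\left(xe_1+\sin(x)e_2+ye_{n+1},\,t\right)$$ is an isometric embedding which is not a homogeneous homomorphism.
   Context: For $n\geq 1$, the Heisenberg group $\mathbb{H}^n$ is the set $\mathbb{R}^{2n}\times\mathbb{R}$ with group law $(z,t)\ast(z',t')=(z+z',\,t+t'+2\omega_n(z,z'))$, where $\omega_n(z,z')=\langle z,J_nz'\rangle$, $J_n=\begin{pmatrix}0&-E_n\\ E_n&0\end{pmatrix}$ and $E_n$ is the $n\times n$ identity matrix; $(z,t)^{-1}=(-z,-t)$. For $\lambda>0$ the dilation is $\delta_\lambda(z,t)=(\lambda z,\lambda^2t)$. $e_1,\dots,e_{2n}$ is the standard basis of $\mathbb{R}^{2n}$. For $a>0$, $N_{\infty,a}(z,t)=\max\{\|z\|_\infty,\,a\sqrt{|t|}\}$ on $\mathbb{H}^k$ ($k=1$ for the source, $k=n$ for the target), where $\|\cdot\|_\infty$ is the maximum norm on $\mathbb{R}^{2k}$, and $d_{N_{\infty,a}}(p,q)=N_{\infty,a}(p^{-1}\ast q)$. An isometric embedding is a distance-preserving map (not necessarily surjective). A homogeneous homomorphism $A:\mathbb{H}^m\to\mathbb{H}^n$ is a group homomorphism with $A(\delta_\lambda(p))=\delta_\lambda(A(p))$ for all $\lambda>0$, $p\in\mathbb{H}^m$. *)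

(* Defs.v *)
From HB Require Import structures.
From mathcomp Require Import all_boot all_order all_algebra.
From mathcomp Require Import ring.
From mathcomp Require Import all_classical all_reals all_analysis.
Set Implicit Arguments.
Unset Strict Implicit.
Unset Printing Implicit Defensive.
Import Order.TTheory GRing.Theory Num.Theory.
Import numFieldNormedType.Exports.
Local Open Scope ring_scope.

Section HeisenbergGroup.
Context {R : realType} {n : nat}.

(* J_n = (0, -E_n; E_n, 0) acting on column vectors of R^{2n} = R^{n+n}. *)
Definition symplectic_mx : 'M[R]_(n + n) := block_mx 0 (- 1%:M) 1%:M 0.

Definition omega (z z' : 'cV[R]_(n + n)) : R :=
  \sum_(i < n + n) z i 0 * (symplectic_mx *m z') i 0.

Lemma omegaDl z1 z2 z : omega (z1 + z2) z = omega z1 z + omega z2 z.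
Proof.
by rewrite /omega -big_split; apply: eq_bigr => i _; rewrite mxE mulrDl.
Qed.

Lemma omegaDr z z1 z2 : omega z (z1 + z2) = omega z z1 + omega z z2.
Proof.
rewrite /omega -big_split; apply: eq_bigr => i _.
by rewrite mulmxDr mxE mulrDr.
Qed.

Lemma omegaNl z z' : omega (- z) z' = - omega z z'.
Proof.
by rewrite /omega -sumrN; apply: eq_bigr => i _; rewrite mxE mulNr.
Qed.

Lemma omegaxx z : omega z z = 0.
Proof.
rewrite -(vsubmxK z); move: (usubmx z) (dsubmx z) => u v.
rewrite /omega big_split_ord /= /symplectic_mx mul_block_col.
rewrite !mul0mx !mulNmx !mul1mx add0r addr0 -big_split big1 // => i _ /=.
by rewrite !col_mxEu !col_mxEd !mxE mulrN mulrC addNr.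
Qed.

End HeisenbergGroup.

(* The alias carries the Heisenberg group law, not the one of a product. *)
Definition heisenberg (R : realType) (n : nat) : Type := ('cV[R]_(n + n) * R)%type.

HB.instance Definition _ (R : realType) (n : nat) :=
  Choice.on (heisenberg R n).

Section HeisenbergLaw.
Context {R : realType} {n : nat}.
Implicit Types p q r : heisenberg R n.

Definition heis_mul p q : heisenberg R n :=
  (p.1 + q.1, p.2 + q.2 + 2 * omega p.1 q.1).

Definition heis_one : heisenberg R n := (0, 0).

Definition heis_inv p : heisenberg R n := (- p.1, - p.2).

Lemma heis_mulA : associative heis_mul.
Proof.
move=> p q r; rewrite /heis_mul /= omegaDl omegaDr addrA; congr pair.
ring.
Qed.

Lemma omega0l z : @omega R n 0 z = 0.
Proof. by rewrite /omega big1 // => i _; rewrite mxE mul0r. Qed.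

Lemma omega0r z : @omega R n z 0 = 0.
Proof. by rewrite /omega big1 // => i _; rewrite mulmx0 mxE mulr0. Qed.

Lemma heis_mul1g : left_id heis_one heis_mul.
Proof. by case=> z t; rewrite /heis_mul /= omega0l mulr0 !add0r addr0. Qed.

Lemma heis_mulg1 : right_id heis_one heis_mul.
Proof. by case=> z t; rewrite /heis_mul /= omega0r mulr0 !addr0. Qed.

Lemma heis_mulVg : left_inverse heis_one heis_inv heis_mul.
Proof.
by case=> z t; rewrite /heis_mul /= omegaNl omegaxx oppr0 mulr0 !addNr addr0.
Qed.

Lemma heis_mulgV : right_inverse heis_one heis_inv heis_mul.
Proof.
case=> z t; rewrite /heis_mul /= -[X in omega X _]opprK omegaNl omegaxx.
by rewrite oppr0 mulr0 !subrr addr0.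
Qed.

HB.instance Definition _ := isGroup.Build (heisenberg R n)
  heis_mulA heis_mul1g heis_mulg1 heis_mulVg heis_mulgV.

Definition dilation (lambda : R) p : heisenberg R n :=
  (lambda *: p.1, lambda ^+ 2 * p.2).

(* On matrices, `|_| is the maximum of the absolute values of the entries. *)
Definition heis_norm (a : R) p : R :=
  Num.max `|p.1| (a * Num.sqrt `|p.2|).

Definition heis_dist (a : R) p q : R := heis_norm a (p^-1 * q)%g.

(* k counts from 1: std_basis 1, ..., std_basis (n + n). *)
Definition std_basis (k : nat) : 'cV[R]_(n + n) :=
  \col_(i < n + n) (i.+1 == k)%:R.

End HeisenbergLaw.

Definition isometric_embedding (X Y : Type) (R : realType)
    (dX : X -> X -> R) (dY : Y -> Y -> R) (f : X -> Y) : Prop :=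
  forall p q, dY (f p) (f q) = dX p q.

Definition homogeneous_homomorphism (R : realType) (m n : nat)
    (A : heisenberg R m -> heisenberg R n) : Prop :=
  {morph A : p q / (p * q)%g} /\
  forall lambda : R, 0 < lambda ->
    forall p, A (dilation lambda p) = dilation lambda (A p).

Definition sin_map (R : realType) (n : nat) (p : heisenberg R 1) :
    heisenberg R n :=
  let x := p.1 ord0 0 in
  let y := p.1 ord_max 0 in
  let t := p.2 in
  (x *: std_basis 1 + sin x *: std_basis 2 + y *: std_basis n.+1, t).

(* Main.v *)
Require Import Defs.
From mathcomp Require Import all_boot all_order all_algebra.
From mathcomp Require Import all_classical all_reals all_analysis.
Import Order.TTheory GRing.Theory Num.Theory.
Import numFieldNormedType.Exports.
Local Open Scope ring_scope.

(** Left-translating [f p] back from [f q] gives the horizontal part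
    [dx e_1 + (sin x' - sin x) e_2 + dy e_(n+1)].  The maximum norm does not
    see the [e_2]-coordinate, because sine is 1-Lipschitz
    ([sin_dist_le]) and so this coordinate is dominated by [dx].  The symplectic
    form does not see it either, because [e_2] is only paired with [e_(n+2)],
    along which the image of [f] has no component ([omega_first_pair]).  Hence
    both the horizontal and the vertical part of the distance are the ones of
    the first Heisenberg group; [heis_dist_first_pair] computes source and
    target distances by one and the same formula.

    On the other hand [f] does not commute with the dilation of factor 2, since
    the sine is not a linear function: [sin (2 * (pi / 2)) = 0], whereas
    [2 * sin (pi / 2) = 2]. *)

Lemma sin_dist_le (R : realType) (x y : R) : `|sin x - sin y| <= `|x - y|.
Proof.
wlog yx : x y / y <= x => [hwlog|].
  have [/hwlog //|/ltW/hwlog] := leP y x.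
  by rewrite distrC (distrC y).
have [|c _ ->] := @MVT_segment R sin cos y x yx (fun z _ => is_derive_sin z).
  exact/continuous_subspaceT/continuous_sin.
by rewrite normrM ler_piMl// cos_max.
Qed.

Lemma mx_norm_leP (R : realType) (m n : nat) (A : 'M[R]_(m, n)) (r : R) :
  0 <= r -> reflect (forall i j, `|A i j| <= r) (`|A| <= r).
Proof.
move=> r0; rewrite [X in X <= r]/Num.Def.normr /= mx_normrE.
apply: (iffP (bigmax_leP _ _ _ _)) => [[_ h] i j|h]; first exact: (h (i, j)).
by split=> // -[i j] _ /=; exact: h.
Qed.

Lemma omegaE (R : realType) (n : nat) (z z' : 'cV[R]_(n + n)) :
  omega z z' = \sum_(i < n) (z (rshift n i) 0 * z' (lshift n i) 0
                             - z (lshift n i) 0 * z' (rshift n i) 0).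
Proof.
rewrite -(vsubmxK z'); move: (usubmx z') (dsubmx z') => u v.
rewrite /omega big_split_ord /= /symplectic_mx mul_block_col.
rewrite !mul0mx !mulNmx !mul1mx add0r addr0 -big_split.
apply: eq_bigr => i _ /=.
by rewrite !col_mxEu !col_mxEd !mxE mulrN addrC.
Qed.

(** The form pairs the coordinates [k] and [n + k]; a pair contributes nothing
    when both vectors vanish at its second coordinate. *)
Lemma omega_first_pair (R : realType) (n : nat) (z z' : 'cV[R]_(n.+1 + n.+1)) :
  (forall i, i != ord0 -> z (rshift n.+1 i) 0 = 0) ->
  (forall i, i != ord0 -> z' (rshift n.+1 i) 0 = 0) ->
  omega z z' = z (rshift n.+1 ord0) 0 * z' (lshift n.+1 ord0) 0
               - z (lshift n.+1 ord0) 0 * z' (rshift n.+1 ord0) 0.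
Proof.
move=> hz hz'; rewrite omegaE (bigD1 ord0) //= big1 ?addr0// => i i0.
by rewrite hz// hz'// mul0r mulr0 subrr.
Qed.

Lemma heis_distE (R : realType) (n : nat) (a : R) (p q : heisenberg R n) :
  heis_dist a p q =
  Num.max `|q.1 - p.1| (a * Num.sqrt `|q.2 - p.2 - 2 * omega p.1 q.1|).
Proof.
rewrite /heis_dist /heis_norm.
have -> : (p^-1 * q)%g = heis_mul (heis_inv p) q by [].
by rewrite /heis_mul /= omegaNl mulrN [- p.1 + _]addrC [- p.2 + _]addrC.
Qed.

(** Every pair of points of the first Heisenberg group satisfies the
    hypotheses, and so does every pair of points of the image of the sine map:
    on both sides the distance is the same function of the first symplectic
    pair of coordinates and of the vertical one. *)
Lemma heis_dist_first_pair (R : realType) (n : nat) (a : R)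
    (p q : heisenberg R n.+1) :
  let x (p : heisenberg R n.+1) := p.1 (lshift n.+1 ord0) 0 in
  let y (p : heisenberg R n.+1) := p.1 (rshift n.+1 ord0) 0 in
  (forall i, i != ord0 -> p.1 (rshift n.+1 i) 0 = 0) ->
  (forall i, i != ord0 -> q.1 (rshift n.+1 i) 0 = 0) ->
  (forall i, `|q.1 i 0 - p.1 i 0| <= Num.max `|x q - x p| `|y q - y p|) ->
  heis_dist a p q =
  Num.max (Num.max `|x q - x p| `|y q - y p|)
    (a * Num.sqrt `|q.2 - p.2 - 2 * (y p * x q - x p * y q)|).
Proof.
move=> x y hp hq hmax; rewrite heis_distE omega_first_pair//.
congr (Num.max _ _); apply/eqP; rewrite eq_le; apply/andP; split.
  apply/mx_norm_leP => [|i j]; first by rewrite le_max normr_ge0.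
  by rewrite ord1 !mxE.
have /mx_norm_leP h : `|q.1 - p.1| <= `|q.1 - p.1| by [].
rewrite ge_max; apply/andP; split.
  by have := h (normr_ge0 _) (lshift n.+1 ord0) 0; rewrite !mxE.
by have := h (normr_ge0 _) (rshift n.+1 ord0) 0; rewrite !mxE.
Qed.

Lemma sin_mapE (R : realType) (n : nat) (p : heisenberg R 1) (i : 'I_(n + n)) :
  (@sin_map R n p).1 i 0 =
  p.1 ord0 0 * (i == 0 :> nat)%:R + sin (p.1 ord0 0) * (i == 1 :> nat)%:R
  + p.1 ord_max 0 * (i == n :> nat)%:R.
Proof. by rewrite !mxE !eqSS. Qed.

Lemma sin_map_isometric (R : realType) (n : nat) (a : R) : (2 <= n)%N ->
  isometric_embedding (@heis_dist R 1 a) (@heis_dist R n a) (@sin_map R n).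
Proof.
case: n => [|[|n]]// _ p q.
have xE r : (@sin_map R n.+2 r).1 (lshift n.+2 ord0) 0 = r.1 ord0 0.
  by rewrite sin_mapE /= mulr1 !mulr0 !addr0.
have yE r : (@sin_map R n.+2 r).1 (rshift n.+2 ord0) 0 = r.1 ord_max 0.
  by rewrite sin_mapE /= addn0 eqxx mulr1 !mulr0 !add0r.
have y0 r i : i != ord0 -> (@sin_map R n.+2 r).1 (rshift n.+2 i) 0 = 0.
  rewrite -val_eqE sin_mapE /= => /negbTE i0.
  by rewrite -{3}[n.+2]addn0 eqn_add2l i0 !mulr0 !addr0.
have dle (i : 'I_(n.+2 + n.+2)) :
    `|(@sin_map R n.+2 q).1 i 0 - (@sin_map R n.+2 p).1 i 0| <=
    Num.max `|q.1 ord0 0 - p.1 ord0 0| `|q.1 ord_max 0 - p.1 ord_max 0|.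
  rewrite !sin_mapE.
  (* The cases below follow the directions of [x], [sin x] and [y]; the
     difference vanishes in all others. *)
  have [->|i0] := eqVneq (i : nat) 0%N.
    by rewrite /= !mulr1 !mulr0 !addr0 le_max lexx.
  have [->|i1] := eqVneq (i : nat) 1%N.
    by rewrite /= !mulr1 !mulr0 !addr0 !add0r le_max sin_dist_le.
  rewrite !mulr0 !add0r; case: eqVneq => _.
    by rewrite !mulr1 le_max lexx orbT.
  by rewrite !mulr0 subrr normr0 le_max normr_ge0.
rewrite heis_dist_first_pair ?xE ?yE; [|exact: y0|exact: y0|exact: dle].
have x1 : lshift 1 ord0 = ord0 :> 'I_(1 + 1) by apply: val_inj.
have y1 : rshift 1 ord0 = ord_max :> 'I_(1 + 1) by apply: val_inj.
rewrite heis_dist_first_pair ?x1 ?y1//; try by move=> i; rewrite ord1.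
move=> i; have [->|->] : i = ord0 \/ i = ord_max.
  by case: i => -[|[|//]] i; [left|right]; apply: val_inj.
- by rewrite le_max lexx.
- by rewrite le_max lexx orbT.
Qed.

Lemma sin_map_not_homogeneous (R : realType) (n : nat) : (2 <= n)%N ->
  ~ homogeneous_homomorphism (@sin_map R n).
Proof.
case: n => [|[|n]]// _ [_ /(_ 2 (ltr0Sn _ _))].
move=> /(_ (const_mx (pi / 2), 0))/(congr1 fst).
move=> /matrixP /(_ (lshift n.+2 (lift ord0 ord0)) 0).
rewrite sin_mapE [RHS]mxE sin_mapE /= !mxE !mulr0 !mulr1 !addr0 !add0r.
rewrite mulrC divfK ?pnatr_eq0// sinpi sin_pihalf mulr1 => /eqP.
by rewrite eq_sym pnatr_eq0.
Qed.

Theorem proposition5p24 (R : realType) (n : nat) (hn : (2 <= n)%N)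
    (a : R) (ha0 : 0 < a) (ha : a <= 1 / Num.sqrt n%:R) :
  isometric_embedding (@heis_dist R 1 a) (@heis_dist R n a) (@sin_map R n) /\
  ~ homogeneous_homomorphism (@sin_map R n).
Proof.
by split; [exact: sin_map_isometric | exact: sin_map_not_homogeneous].
Qed.
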